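(* For all integers $a\ge 1$ and $n\ge 1$, the diameter of $\Pi^a_n$ is $$d(\Pi^a_n)=an-1 .$$ The periphery of $\Pi^a_n$ is $P(\Pi^a_n)=\{u,w\}$, where $u=0a0a\cdots$ is the word of length $n$ with $u_i=0$ for $i$ odd and $u_i=a$ for $i$ even, and $w=(a-1)0a0a\cdots$ is the word of length $n$ with $w_1=a-1$, $w_i=0$ for $i$ even and $w_i=a$ for odd $i\ge 3$.
   Context: For integers $a\ge 1$ and $n\ge 0$, let $\mathcal{S}^a_n$ be the set of all words $\alpha_1\cdots\alpha_n$ of length $n$ over the alphabet $\{0,1,\dots,a\}$ such that the letter $a$ appears only immediately after a letter $0$ (so $\alpha_1\ne a$, and $\alpha_i=a$ implies $\alpha_{i-1}=0$). The metallic cube $\Pi^a_n$ is the simple graph with vertex set $\mathcal{S}^a_n$ in which two vertices $\alpha,\beta$ are adjacent if and only if $\sum_{k=1}^n|\alpha_k-\beta_k|=1$, i.e. one is obtained from the other by replacing a single letter $k$ by $k+1$, $0\le k\le a-1$. For a connected graph $G$, $d(v,w)$ is the shortest-path distance, $e(v)=\max_{w\in V(G)}d(v,w)$ is the eccentricity of $v$, the diameter is $d(G)=\max_{v\in V(G)}e(v)$, and the periphery is $P(G)=\{v\in V(G): e(v)=d(G)\}$. *)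

(* Defs.v *)
From mathcomp Require Import all_boot all_order all_algebra.
Set Implicit Arguments.
Unset Strict Implicit.
Unset Printing Implicit Defensive.

Section GraphDistance.
Variables (T : finType) (e : rel T).

(* Length of a shortest path from x to y; since a shortest path has fewer than
   #|T| edges, the value #|T| occurs only when y is not reachable from x. *)
Definition gdist (x y : T) : nat :=
  \big[minn/#|T|]_(k < #|T| |
      [exists p : k.-tuple T, path e x p && (last x p == y)]) k.

Definition eccentricity (x : T) : nat := \max_(y : T) gdist x y.

Definition diameter : nat := \max_(x : T) eccentricity x.

Definition periphery : {set T} := [set x | eccentricity x == diameter].

Lemma gdist_le_path x p : path e x p -> gdist x (last x p) <= size p.
Proof.
case/shortenP=> q eq uq sub_qp; apply: (@leq_trans (size q)); last first.
  by apply: uniq_leq_size sub_qp; case/andP: uq.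
have lt_q : size q < #|T| by rewrite -[_.+1]/(size (x :: q)) -(card_uniqP uq) max_card.
rewrite -leEnat /gdist -minEnat; apply: (Order.TotalTheory.bigmin_le_cond _ (j := Ordinal lt_q)).
by apply/existsP; exists (in_tuple q); rewrite /= eq eqxx.
Qed.

Lemma gdist_path x y : connect e x y ->
  exists p, [/\ path e x p, last x p = y & size p = gdist x y].
Proof.
case/connectP=> p ep ->; have := gdist_le_path ep.
have lt_d : gdist x (last x p) < #|T|.
  case/shortenP: ep => q eq uq _; apply: leq_ltn_trans (gdist_le_path eq) _.
  by rewrite -[_.+1]/(size (x :: q)) -(card_uniqP uq) max_card.
move=> _; move: lt_d; rewrite /gdist.
elim/big_ind: _ => [|m1 m2 IH1 IH2|k /existsP[q /andP[eq /eqP lq]] _].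
- by rewrite ltnn.
- by rewrite /minn; case: ifP.
by exists q; rewrite size_tuple.
Qed.

End GraphDistance.

Section MetallicCube.
Variables a n : nat.

(* Positions are numbered from 0: the letter alpha_i is the value at i.-1.
   Requiring a predecessor position also excludes the letter a in front. *)
Definition metallic_word (s : {ffun 'I_n -> 'I_a.+1}) : bool :=
  [forall i : 'I_n, (s i == a :> nat) ==>
     [exists j : 'I_n, (j.+1 == i) && (s j == 0 :> nat)]].

Definition metallic_vertex := {s : {ffun 'I_n -> 'I_a.+1} | metallic_word s}.

Definition metallic_cube : rel metallic_vertex :=
  fun x y => \sum_(k < n) `|val x k - val y k|%N == 1.

Definition metallic_u : {ffun 'I_n -> 'I_a.+1} :=
  [ffun i : 'I_n => if odd i then ord_max else ord0].

Definition metallic_w : {ffun 'I_n -> 'I_a.+1} :=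
  [ffun i : 'I_n => if i == 0 :> nat then inord a.-1
                    else if odd i then ord0 else ord_max].

Lemma metallic_cube_sym : symmetric metallic_cube.
Proof. by move=> x y; rewrite /metallic_cube; under eq_bigr do rewrite distnC. Qed.

Lemma metallic_cube_irr : irreflexive metallic_cube.
Proof. by move=> x; rewrite /metallic_cube big1 // => k _; rewrite distnn. Qed.

Lemma metallic_cube_connected x y : connect metallic_cube x y.
Proof.
have down (z : metallic_vertex) : 0 < \sum_k val z k ->
    exists2 t, metallic_cube z t & \sum_k val t k < \sum_k val z k.
  rewrite lt0n sum_nat_eq0 => /forallPn[k]; rewrite /= -lt0n => zk_gt0.
  pose f : {ffun 'I_n -> 'I_a.+1} :=
    [ffun i => if i == k then inord (val z k).-1 else val z i].
  have fk : f k = (val z k).-1 :> nat.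
    by rewrite ffunE eqxx inordK // (leq_ltn_trans (leq_pred _)).
  have fD i : i != k -> f i = val z i by rewrite ffunE => /negPf->.
  have f_word : metallic_word f.
    apply/forallP=> i; apply/implyP=> /eqP fi.
    have [ik | nik] := eqVneq i k.
      move: fi (ltn_ord (val z k)); rewrite ik fk => /(congr1 succn).
      by rewrite prednK // => ->; rewrite ltnn.
    have /forallP/(_ i)/implyP := valP z; rewrite -(fD i nik) fi eqxx => /(_ isT).
    case/existsP=> j /andP[ji /eqP zj]; apply/existsP; exists j; rewrite ji.
    by rewrite fD ?zj //; apply: contraTneq zk_gt0 => <-; rewrite zj.
  exists (exist _ f f_word).
    rewrite /metallic_cube (bigD1 k) //= fk big1 ?addn0 => [|i /fD->]; last by rewrite distnn.
    by move: zk_gt0; case: (nat_of_ord (val z k)) => // m _; rewrite distnEl ?subSnn /=.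
  rewrite [X in _ < X](bigD1 k) // [X in X < _](bigD1 k) //= fk.
  by rewrite (eq_bigr (fun i => val z i : nat)) ?ltn_add2r ?ltn_predL // => i /fD->.
have conn0 m (z : metallic_vertex) : \sum_k val z k <= m ->
    exists2 t : metallic_vertex, connect metallic_cube z t & \sum_k val t k = 0.
  elim: m z => [|m IHm] z; first by rewrite leqn0 => /eqP; exists z.
  move=> le_zm; have [z0 | /down[t ezt lt_tz]] := posnP (\sum_k val z k).
    by exists z.
  have [|s cts s0] := IHm t; first by rewrite -ltnS (leq_trans lt_tz).
  by exists s => //; apply: connect_trans (connect1 ezt) cts.
have [[s csx s0] [t cty t0]] := (conn0 _ x (leqnn _), conn0 _ y (leqnn _)).
have ts : t = s.
  apply/val_inj/ffunP=> k; apply/val_inj => /=.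
  move/eqP: s0; move/eqP: t0; rewrite !sum_nat_eq0.
  by move=> /forallP/(_ k)/eqP-> /forallP/(_ k)/eqP->.
by apply: connect_trans csx _; rewrite -ts (sym_connect_sym metallic_cube_sym).
Qed.

End MetallicCube.

(* Main.v *)
Require Import Defs.
From mathcomp Require Import all_boot all_order all_algebra.
From mathcomp Require Import zify.

(** The theorem reduces to a computation with the Manhattan distance [wdist] of
    words, because the cube is isometrically embedded in the grid
    ([gdist_metallic_cube]): lowering a nonzero letter never leaves the set of
    words, since it creates no letter [a] and the letter behind a nonzero letter
    is not [a].  Hence one reaches [y] from [x] on a shortest grid path by
    lowering letters from [x] to the letterwise minimum of [x] and [y], and then
    running backwards the lowering of [y] to it.

    In each position two letters differ by at most [a], and by at most [a - 1]
    in front, where [a] is excluded; summing gives [a * n - 1].  Equality means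
    that every position is extremal.  Behind the front, one of the two words
    then has [a] and the other [0], and the letter before this [a] must be [0],
    so the letters in position [i] determine those in position [i - 1].
    Starting from the last position, the pair of words is therefore determined
    up to exchange ([extremal_pair_words]), and it is the pair of alternating words
    [metallic_u] and [metallic_w]. *)

(** * The graph distance is the Manhattan distance *)

Section MetallicDistance.
Set Implicit Arguments.
Unset Strict Implicit.
Variables a n : nat.
Implicit Types x y z : metallic_vertex a n.

Definition letter x (k : 'I_n) : nat := val x k.

Lemma letter_le x k : letter x k <= a.
Proof. by rewrite -ltnS /letter. Qed.

Definition wdist x y : nat := \sum_(k < n) `|letter x k - letter y k|%N.

Lemma wdistC x y : wdist x y = wdist y x.
Proof. by apply: eq_bigr => k _; rewrite distnC. Qed.

Lemma wdist_triangle x y z : wdist x z <= wdist x y + wdist y z.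
Proof. by rewrite /wdist -big_split; apply: leq_sum => k _; apply: leqD_dist. Qed.

Lemma wdist_eq0 x y : wdist x y = 0 -> x = y.
Proof.
move/eqP; rewrite sum_nat_eq0 => /forallP xy0.
apply/val_inj/ffunP=> k; apply/val_inj; change (letter x k = letter y k).
by have /= /eqP := xy0 k; lia.
Qed.

Lemma metallic_pred x (i : 'I_n) : letter x i = a ->
  exists2 j : 'I_n, j.+1 = i & letter x j = 0.
Proof.
move=> xi; have /forallP/(_ i)/implyP := valP x.
rewrite -/(letter x i) xi eqxx => /(_ isT)/existsP[j /andP[/eqP ji /eqP xj]].
by exists j.
Qed.

(** The predecessor position of a letter [a] holds [0], so lowering a nonzero
    letter does not affect the condition at the next position. *)
Lemma lower_letter x (k : 'I_n) : 0 < letter x k ->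
  exists2 z : metallic_vertex a n, letter z k = (letter x k).-1 &
    forall i, i != k -> letter z i = letter x i.
Proof.
move=> xk_gt0.
pose f : {ffun 'I_n -> 'I_a.+1} :=
  [ffun i => if i == k then inord (val x k).-1 else val x i].
have fk : f k = (val x k).-1 :> nat.
  by rewrite ffunE eqxx inordK // (leq_ltn_trans (leq_pred _)).
have fD i : i != k -> f i = val x i by rewrite ffunE => /negPf->.
suff f_word : metallic_word f.
  by exists (exist _ f f_word) => [|i /fD fi]; rewrite /letter /= ?fk ?fi.
apply/forallP=> i; apply/implyP=> /eqP fi.
have [ik | nik] := eqVneq i k.
  by move: fi xk_gt0 (letter_le x k); rewrite ik fk -/(letter x k); lia.
rewrite fD // -/(letter x i) in fi; have [j ji xj] := metallic_pred fi.
apply/existsP; exists j; rewrite ji eqxx fD -?/(letter x j) ?xj //.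
by apply: contraTneq xk_gt0 => <-; rewrite xj.
Qed.

Lemma step_toward x y (k : 'I_n) : letter y k < letter x k ->
  exists2 z, metallic_cube x z & wdist x y = (wdist z y).+1.
Proof.
move=> lt_yx; have [|z zk zD] := @lower_letter x k; first by lia.
exists z.
  rewrite /metallic_cube -/(wdist x z) /wdist (bigD1 k) // big1 => [|i /zD->].
    by apply/eqP => /=; lia.
  by rewrite distnn.
rewrite /wdist (bigD1 k) //= [in RHS](bigD1 k) //= -addSn; congr (_ + _); first by lia.
by apply: eq_bigr => i /zD->.
Qed.

Lemma wdist_path x y :
  exists p, [/\ path (@metallic_cube a n) x p, last x p = y & size p = wdist x y].
Proof.
move: {2}(wdist x y) (erefl (wdist x y)) => d.
elim: d x y => [|d IHd] x y xy.
  by exists [::]; rewrite xy (wdist_eq0 xy).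
have /existsP[k xyk] : [exists k, letter x k != letter y k].
  apply/contraPT: xy => /existsPn xy; rewrite /wdist big1 // => k _.
  by have /negbNE/eqP-> := xy k; rewrite distnn.
(* Raising a letter of [x] may create an illegal [a]; where [y] is larger, the
   letter of [y] is lowered instead and [y] becomes the last step of the path. *)
have [lt_yx | lt_xy | eq_xy] := ltngtP (letter y k) (letter x k).
- have [z xz xyS] := step_toward lt_yx.
  have [|p [zp zy sz]] := IHd z y; first by lia.
  by exists (z :: p); rewrite /= xz zp sz xyS.
- have [z yz yxS] := step_toward lt_xy; rewrite wdistC in yxS.
  rewrite [wdist z x]wdistC in yxS.
  have [|p [xp pz sz]] := IHd x z; first by lia.
  exists (rcons p y); rewrite rcons_path last_rcons size_rcons xp pz sz yxS.
  by rewrite metallic_cube_sym yz.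
by rewrite eq_xy eqxx in xyk.
Qed.

Lemma wdist_le_size x p : path (@metallic_cube a n) x p -> wdist x (last x p) <= size p.
Proof.
elim: p x => [|z p IHp] x /=; first by rewrite /wdist big1 // => k _; rewrite distnn.
case/andP=> /eqP xz /IHp zp; apply: leq_trans (wdist_triangle x z _) _.
by rewrite [wdist x z]xz.
Qed.

Lemma gdist_metallic_cube x y : gdist (@metallic_cube a n) x y = wdist x y.
Proof.
apply/eqP; rewrite eqn_leq; apply/andP; split.
  by have [p [xp <- <-]] := wdist_path x y; apply: gdist_le_path.
have [p [xp <- <-]] := gdist_path (metallic_cube_connected x y).
exact: wdist_le_size.
Qed.

(** * Words at maximal distance *)

Lemma letter_front x (k : 'I_n) : k = 0 :> nat -> letter x k < a.
Proof.
move=> k0; rewrite ltn_neqAle letter_le andbT; apply/eqP => /metallic_pred[j].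
by rewrite k0.
Qed.

(** The maximal difference of two letters in position [k]; positions are numbered
    from 0, and in front the letter [a] is excluded. *)
Definition gap_bound (k : 'I_n) := a - (k == 0 :> nat).

Lemma letter_gap x y (k : 'I_n) : `|letter x k - letter y k|%N <= gap_bound k.
Proof.
have [] := (letter_le x k, letter_le y k); rewrite /gap_bound.
by case: eqP => [k0|_]; [have [] := (letter_front x k0, letter_front y k0)|]; lia.
Qed.

Lemma sum_gap_bound : 1 <= a -> 1 <= n -> \sum_(k < n) gap_bound k = a * n - 1.
Proof.
rewrite /gap_bound; case: n => // m a_gt0 _; rewrite big_ord_recl /=.
under eq_bigr do rewrite subn0.
by rewrite sum_nat_const card_ord; nia.
Qed.

Lemma wdist_leif x y : 1 <= a -> 1 <= n ->
  wdist x y <= a * n - 1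
    ?= iff [forall k : 'I_n, `|letter x k - letter y k|%N == gap_bound k].
Proof.
move=> a_gt0 n_gt0; rewrite -sum_gap_bound //; apply: leqif_sum => k _.
by split=> //; apply: letter_gap.
Qed.

Lemma metallic_uE (k : 'I_n) : metallic_u a n k = (if odd k then a else 0) :> nat.
Proof. by rewrite ffunE; case: ifP. Qed.

Lemma metallic_wE (k : 'I_n) :
  metallic_w a n k = (if odd k then 0 else gap_bound k) :> nat.
Proof.
rewrite ffunE /gap_bound; case: eqP => [->|_] /=; last by rewrite subn0; case: ifP.
by rewrite inordK ?subn1 // ltnS leq_pred.
Qed.

Definition extremal_pair x y :=
  forall k : 'I_n, `|letter x k - letter y k|%N = gap_bound k.

Lemma extremal_pair_sym x y : extremal_pair x y -> extremal_pair y x.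
Proof. by move=> xy k; rewrite distnC. Qed.

Lemma extremal_pair_uw x y (k : 'I_n) : extremal_pair x y ->
  letter x k = metallic_u a n k -> letter y k = metallic_w a n k.
Proof.
move=> /(_ k) + xk; rewrite xk metallic_uE metallic_wE.
have := letter_le y k; rewrite /gap_bound.
by case: (nat_of_ord k) => [|m] /=; [|case: (odd m) => /=]; lia.
Qed.

(** If [i] is odd, then [x] has [a] there, hence [0] before it.  If [i] is even,
    then it is not the front, since [j] precedes it; so [y] has [a] in position
    [i] and [0] in position [j], where the gap [a] leaves only [a] for [x]. *)
Lemma extremal_pair_pred x y (i j : 'I_n) : extremal_pair x y -> j.+1 = i ->
  letter x i = metallic_u a n i -> letter x j = metallic_u a n j.
Proof.
move=> xy ji xi; have yi := extremal_pair_uw xy xi.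
have before z : letter z i = a -> letter z j = 0.
  by case/metallic_pred=> k; rewrite -ji => -[/val_inj->].
move: xi yi; rewrite !metallic_uE metallic_wE -ji /=.
have [j_odd _ yi | _ xi _] := boolP (odd j); last exact: before.
have {}yi : letter y j = 0 by apply: before; rewrite yi /gap_bound -ji subn0.
have := xy j; rewrite yi /gap_bound.
by case: (nat_of_ord j) j_odd => //= m _; lia.
Qed.

(** A gap as large as [gap_bound] is only possible between the smallest and the
    largest letter allowed in a position, so in the last position one of the two
    words has the letter of [metallic_u].  [extremal_pair_pred] then carries the
    agreement to the front. *)
Lemma extremal_pair_words x y : 1 <= n -> extremal_pair x y ->
  (val x = metallic_u a n /\ val y = metallic_w a n) \/
  (val x = metallic_w a n /\ val y = metallic_u a n).
Proof.
move=> n_gt0; have lt_l : n.-1 < n by rewrite ltn_predL.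
pose l := Ordinal lt_l.
have words x' y' : extremal_pair x' y' -> letter x' l = metallic_u a n l ->
    val x' = metallic_u a n /\ val y' = metallic_w a n.
  move=> xy xl; suff xu (k : 'I_n) : letter x' k = metallic_u a n k.
    split; apply/ffunP=> k; apply/val_inj; first exact: xu.
    exact: extremal_pair_uw xy (xu k).
  have [d] := ubnP (n.-1 - k); elim: d k => // d IHd k le_kd.
  have [kl | nkl] := eqVneq (nat_of_ord k) n.-1.
    by rewrite (_ : k = l) //; apply: val_inj.
  have lt_k : k.+1 < n by have := ltn_ord k; move/eqP: nkl; lia.
  apply: (extremal_pair_pred (i := Ordinal lt_k) xy) => //.
  by apply: IHd => /=; lia.
move=> xy; have yx := extremal_pair_sym xy.
suff [xl | yl] : letter x l = metallic_u a n l \/ letter y l = metallic_u a n l.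
- by left; apply: words.
- by right; have [] := words y x yx yl.
have [xa ya xyl] := And3 (letter_le x l) (letter_le y l) (xy l).
move: xyl; rewrite metallic_uE /gap_bound.
have [l0 | l_neq0] := eqVneq (nat_of_ord l) 0; last by case: ifP; lia.
by have [] := (letter_front x l0, letter_front y l0); rewrite l0 /=; lia.
Qed.

(** * Diameter and periphery *)

Hypotheses (a_gt0 : 1 <= a) (n_gt0 : 1 <= n).

Lemma metallic_word_u : metallic_word (metallic_u a n).
Proof.
apply/forallP=> i; apply/implyP=> /eqP; rewrite metallic_uE.
case: ifP => [i_odd _ | _]; last by lia.
have lt_i : i.-1 < n by apply: leq_ltn_trans (leq_pred i) (ltn_ord i).
apply/existsP; exists (Ordinal lt_i); rewrite metallic_uE /=.
by case: (nat_of_ord i) i_odd => //= m /negPf->; rewrite !eqxx.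
Qed.

Lemma metallic_word_w : metallic_word (metallic_w a n).
Proof.
apply/forallP=> i; apply/implyP=> /eqP; rewrite metallic_wE /gap_bound.
case: ifP => [_ | i_even wi]; first by lia.
have lt_i : i.-1 < n by apply: leq_ltn_trans (leq_pred i) (ltn_ord i).
apply/existsP; exists (Ordinal lt_i); rewrite metallic_wE /=.
have i_gt0 : 0 < i by case: (nat_of_ord i) wi => //=; lia.
have pred_odd : odd i.-1 by rewrite -subn1 oddB // i_even.
by rewrite pred_odd prednK ?eqxx.
Qed.

Definition vertex_u : metallic_vertex a n := exist _ (metallic_u a n) metallic_word_u.
Definition vertex_w : metallic_vertex a n := exist _ (metallic_w a n) metallic_word_w.

Lemma extremal_pair_vertices : extremal_pair vertex_u vertex_w.
Proof.
move=> k; rewrite /letter /= metallic_uE metallic_wE /gap_bound.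
by case: (nat_of_ord k) => [|m] /=; [|case: (odd m) => /=]; lia.
Qed.

Lemma gdist_le x y : gdist (@metallic_cube a n) x y <= a * n - 1.
Proof. by rewrite gdist_metallic_cube wdist_leif. Qed.

Lemma gdist_max x y :
  gdist (@metallic_cube a n) x y = a * n - 1 <-> extremal_pair x y.
Proof.
rewrite gdist_metallic_cube; split=> [/eqP | xy].
  by rewrite wdist_leif // => /forallP xy k; apply/eqP.
by apply/eqP; rewrite wdist_leif //; apply/forallP => k; apply/eqP.
Qed.

Lemma eccentricity_le x : eccentricity (@metallic_cube a n) x <= a * n - 1.
Proof. by apply/bigmax_leqP => y _; apply: gdist_le. Qed.

Lemma eccentricity_max x :
  eccentricity (@metallic_cube a n) x = a * n - 1 <-> exists y, extremal_pair x y.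
Proof.
split=> [ecc | [y /gdist_max xy]]; last first.
  by apply/eqP; rewrite eqn_leq eccentricity_le -xy leq_bigmax.
have [|y xy] := @eq_bigmax _ (gdist (@metallic_cube a n) x).
  by apply/card_gt0P; exists x.
by exists y; apply/gdist_max; rewrite -xy.
Qed.

Lemma diameter_metallic_cube : diameter (@metallic_cube a n) = a * n - 1.
Proof.
apply/eqP; rewrite eqn_leq; apply/andP; split.
  by apply/bigmax_leqP => x _; apply: eccentricity_le.
have /eccentricity_max <- : exists y, extremal_pair vertex_u y.
  by exists vertex_w; apply: extremal_pair_vertices.
exact: leq_bigmax.
Qed.

Lemma periphery_metallic_cube :
  periphery (@metallic_cube a n) = [set vertex_u; vertex_w].
Proof.
apply/setP=> x; rewrite !inE diameter_metallic_cube.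
apply/eqP/orP => [/eccentricity_max[y /extremal_pair_words[//|[xu _]|[xw _]]] | ].
- by left; apply/eqP/val_inj.
- by right; apply/eqP/val_inj.
move=> xuw; apply/eccentricity_max; case: xuw => /eqP->.
- by exists vertex_w; apply: extremal_pair_vertices.
by exists vertex_u; apply/extremal_pair_sym/extremal_pair_vertices.
Qed.

End MetallicDistance.

Theorem theorem10 (a n : nat) (ha : 1 <= a) (hn : 1 <= n) :
  diameter (@metallic_cube a n) = a * n - 1 /\
  [set val v | v in periphery (@metallic_cube a n)] =
    [set metallic_u a n; metallic_w a n].
Proof.
split; first exact: diameter_metallic_cube.
by rewrite periphery_metallic_cube imsetU !imset_set1.
Qed.
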